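(* Let $i\in\mathbb{V}$ be a vertex, and let $\mathcal{P}^{\mathrm{rec}}_{\le i}$ be a recursive preconditioner at $i$ which is exact on the children $j_1,\dots,j_r$ of $i$, i.e. $$\mathcal{P}^{\mathrm{rec}}_{\le j_l}=\mathcal{B}_{\le j_l}\qquad\text{for all } l=1,\dots,r .$$ Then for every right-hand side $h_{\le i}$ the iteration $$x^{(k+1)}_{\le i}=x^{(k)}_{\le i}+(\mathcal{P}^{\mathrm{rec}}_{\le i})^{-1}\bigl(h_{\le i}-\mathcal{B}_{\le i}x^{(k)}_{\le i}\bigr),\qquad k=0,1,2,\dots,$$ converges to the solution of $\mathcal{B}_{\le i}x_{\le i}=h_{\le i}$ in at most two iterations in exact arithmetic (i.e. $x^{(2)}_{\le i}=\mathcal{B}_{\le i}^{-1}h_{\le i}$), independently of the initial iterate $x^{(0)}_{\le i}$.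
   Context: **Data.** Let $\mathbb{D}=(\mathbb{V},\mathbb{A})$ be a directed rooted tree (arborescence) with vertices $\mathbb{V}=\{1,\dots,N\}$ and arcs $\mathbb{A}=\{a_1,\dots,a_M\}$ directed away from the root $R$. Each vertex $i$ has a symmetric matrix $B_i\in\mathbb{R}^{n_i\times n_i}$; each arc $a_k=(i,j)$ has a symmetric $D_k\in\mathbb{R}^{\ell_k\times\ell_k}$ and matrices $C_k^+\in\mathbb{R}^{\ell_k\times n_i}$, $C_k^-\in\mathbb{R}^{\ell_k\times n_j}$. A vertex is a leaf if it has no outgoing arcs, and an inner vertex otherwise. For $i\neq R$ let $\kappa(i)$ be the index of the unique arc entering $i$. For an inner vertex $i$ write its outgoing arcs as $a_{k_1}=(i,j_1),\dots,a_{k_r}=(i,j_r)$. **Nested matrices.** For a leaf $i$: $\mathcal{B}_{\le i}=B_i$, and $\mathcal{C}_i^-=C^-_{\kappa(i)}$ if $i\ne R$. For an inner vertex $i$: $\mathcal{D}_{\le i}=\mathrm{blkdiag}(D_{k_1},\dots,D_{k_r})$, $\mathcal{C}^+_{\le i}$ is the vertical stacking of $C^+_{k_1},\dots,C^+_{k_r}$, $\mathcal{C}^-_{\le i}=\mathrm{blkdiag}(\mathcal{C}^-_{j_1},\dots,\mathcal{C}^-_{j_r})$, and $$\mathcal{B}_{\le i}=\begin{pmatrix}\mathrm{blkdiag}(\mathcal{B}_{\le j_1},\dots,\mathcal{B}_{\le j_r}) & 0 & -(\mathcal{C}^-_{\le i})^T\\ 0 & B_i & (\mathcal{C}^+_{\le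 i})^T\\ -\mathcal{C}^-_{\le i} & \mathcal{C}^+_{\le i} & -\mathcal{D}_{\le i}\end{pmatrix};$$ for $i\neq R$, $\mathcal{C}_i^-=(0\ \cdots\ 0\ C^-_{\kappa(i)}\ 0)$, where $C^-_{\kappa(i)}$ occupies the columns of $\mathcal{B}_{\le i}$ containing the diagonal block $B_i$. For inner $i$, $$\mathcal{S}_{\le i}=\begin{pmatrix}-\mathcal{C}^-_{\le i}&\mathcal{C}^+_{\le i}\end{pmatrix}\mathrm{blkdiag}(\mathcal{B}_{\le j_1}^{-1},\dots,\mathcal{B}_{\le j_r}^{-1},B_i^{-1})\begin{pmatrix}-\mathcal{C}^-_{\le i}&\mathcal{C}^+_{\le i}\end{pmatrix}^T+\mathcal{D}_{\le i}.$$ **Standing assumptions.** All $B_i$ and all $\mathcal{B}_{\le i}$ are invertible, and all $\mathcal{S}_{\le i}$ ($i$ inner) are positive definite. Moreover, with $\mathcal{B}=\mathrm{blkdiag}(B_1,\dots,B_N)$, $\mathcal{D}=\mathrm{blkdiag}(D_1,\dots,D_M)$ and $\mathcal{C}$ the block matrix whose block row for $a_k=(i,j)$ has $C_k^+$ in block column $i$, $-C_k^-$ in block column $j$ and zeros elsewhere, the matrix $\mathcal{C}\mathcal{B}^{-1}\mathcal{C}^T+\mathcal{D}$ is positive definite. **Recursive preconditioner at $i$.** If $i$ is a leaf, $\mathcal{P}^{\mathrm{rec}}_{\le i}=B_i$ (and the exactness condition on children is void). If $i$ is inner, given preconditioners $\mathcal{P}^{\mathrm{rec}}_{\le j_l}$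 (invertible matrices of the same size as $\mathcal{B}_{\le j_l}$) for its children, $$\mathcal{P}^{\mathrm{rec}}_{\le i}=\begin{pmatrix}\mathrm{blkdiag}(\mathcal{P}^{\mathrm{rec}}_{\le j_1},\dots,\mathcal{P}^{\mathrm{rec}}_{\le j_r}) & 0 & 0\\ 0 & B_i & 0\\ -\mathcal{C}^-_{\le i} & \mathcal{C}^+_{\le i} & -\mathcal{S}_{\le i}\end{pmatrix}.$$ *)

(* Defs.v *)
From mathcomp Require Import all_boot all_order all_algebra.
From mathcomp Require Import reals.

Set Implicit Arguments.
Unset Strict Implicit.
Unset Printing Implicit Defensive.

Import GRing.Theory Num.Theory.

Local Open Scope ring_scope.

(** * Arborescences *)

(* [dwalk src tgt u p v]: the arc sequence [p] is a directed walk from [u]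
   to [v]. *)
Fixpoint dwalk (N M : nat) (src tgt : 'I_M -> 'I_N)
    (u : 'I_N) (p : seq 'I_M) (v : 'I_N) : bool :=
  if p is k :: p' then (src k == u) && dwalk src tgt (tgt k) p' v else u == v.

(* Parallel arcs, loops and directed cycles are all excluded by uniqueness of
   the walk; the case [v = root] says that only the empty walk leads from the
   root to itself. *)
Record arborescence (N M : nat) := Arborescence {
  src : 'I_M -> 'I_N;
  tgt : 'I_M -> 'I_N;
  root : 'I_N;
  unique_walk : forall v : 'I_N, exists! p : seq 'I_M, dwalk src tgt root p v
}.

Arguments src {N M}.
Arguments tgt {N M}.
Arguments root {N M}.

Section Tree.
Variables (N M : nat) (T : arborescence N M).

Definition outarcs (i : 'I_N) : {set 'I_M} := [set k | src T k == i].

Definition outdeg (i : 'I_N) : nat := #|outarcs i|.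

(* The [l]-th outgoing arc of [i], in the order of the arc numbering. *)
Definition outarc (i : 'I_N) (l : 'I_(outdeg i)) : 'I_M := enum_val l.

Definition child (i : 'I_N) (l : 'I_(outdeg i)) : 'I_N := tgt T (outarc l).

Definition leaf (i : 'I_N) : bool := outdeg i == 0%N.

Definition is_child (j i : 'I_N) : Prop := exists l : 'I_(outdeg i), j = child l.

Lemma src_outarc (i : 'I_N) (l : 'I_(outdeg i)) : src T (outarc l) = i.
Proof. by have := enum_valP l; rewrite inE => /eqP. Qed.

Lemma is_childP (i : 'I_N) (l : 'I_(outdeg i)) : is_child (child l) i.
Proof. by exists l. Qed.

Lemma dwalk_rcons u p k :
  dwalk (src T) (tgt T) u p (src T k) ->
  dwalk (src T) (tgt T) u (rcons p k) (tgt T k).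
Proof.
elim: p u => [|k' p IH] u /=; first by move=> /eqP->; rewrite !eqxx.
by case/andP=> -> /IH.
Qed.

Lemma depth_exists :
  exists d : 'I_N -> nat, forall k, d (tgt T k) = (d (src T k)).+1.
Proof.
have walk_to v : exists p, dwalk (src T) (tgt T) (root T) p v.
  by have [p [pP _]] := unique_walk T v; exists p.
exists (fun v => size (xchoose (walk_to v))) => k.
have [p [_ pU]] := unique_walk T (tgt T k).
rewrite -(pU _ (xchooseP (walk_to _))).
by rewrite (pU _ (dwalk_rcons (xchooseP (walk_to (src T k))))) size_rcons.
Qed.

(* Distinct arcs enter distinct vertices, so that an arc [k] may be
   identified with the vertex [tgt T k] that it enters. *)
Lemma tgt_inj : injective (tgt T).
Proof.
move=> k1 k2 e; have [p [_ pU]] := unique_walk T (tgt T k1).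
have [p1 [/dwalk_rcons/pU E1 _]] := unique_walk T (src T k1).
have [p2 [/dwalk_rcons + _]] := unique_walk T (src T k2).
by rewrite -e => /pU; rewrite E1 => /rcons_inj [].
Qed.

Lemma is_child_wf : well_founded is_child.
Proof.
have [d dE] := depth_exists.
have [m dm] : exists m, forall v, (d v <= m)%N.
  by exists (\max_v d v)%N => v; apply: leq_bigmax.
move=> i; have [n] := ubnP (m - d i)%N; elim: n i => [i | n IH i lt_i]; first by rewrite ltn0.
constructor=> _ [l ->]; apply: IH; rewrite /child dE src_outarc.
have := dm (child l); rewrite /child dE src_outarc => lt_m.
by rewrite ltnS in lt_i; apply: leq_trans lt_i; rewrite ltn_sub2l.
Qed.

End Tree.

Arguments outarc {N M T i}.
Arguments child {N M T i}.

(** * Matrices attached to the vertices and arcs *)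

Record tree_data (R : realType) (N M : nat) (T : arborescence N M) := TreeData {
  vdim : 'I_N -> nat;
  adim : 'I_M -> nat;
  Bv : forall i : 'I_N, 'M[R]_(vdim i);
  Da : forall k : 'I_M, 'M[R]_(adim k);
  Cplus : forall k : 'I_M, 'M[R]_(adim k, vdim (src T k));
  Cminus : forall k : 'I_M, 'M[R]_(adim k, vdim (tgt T k));
  Bv_sym : forall i, (Bv i)^T = Bv i;
  Da_sym : forall k, (Da k)^T = Da k
}.

Arguments vdim {R N M T}.
Arguments adim {R N M T}.
Arguments Bv {R N M T}.
Arguments Da {R N M T}.
Arguments Cplus {R N M T}.
Arguments Cminus {R N M T}.

Definition posdefmx (R : realType) (n : nat) (A : 'M[R]_n) : Prop :=
  forall v : 'cV[R]_n, v != 0 -> 0 < (v^T *m A *m v) 0 0.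

(* The rectangular analogue of [mxdiag]; as there, [conform_mx 0] is only
   applied to matrices whose size is already the required one. *)
Definition blkdiag (R : realType) (r : nat) (p q : 'I_r -> nat)
    (A : forall l, 'M[R]_(p l, q l)) : 'M[R]_(\sum_l p l, \sum_l q l) :=
  \mxblock_(l, l') (if l == l' then conform_mx 0 (A l) else 0).

Section Nested.
Variables (R : realType) (N M : nat) (T : arborescence N M).
Variable A : tree_data R T.

(** ** Sizes *)

Definition inner_size (i : 'I_N) (s : 'I_(outdeg T i) -> nat) : nat :=
  (\sum_l s l + vdim A i + \sum_(l < outdeg T i) adim A (outarc l))%N.

Arguments inner_size : clear implicits.

Definition size_body (i : 'I_N) (s : 'I_(outdeg T i) -> nat) : nat :=
  if leaf T i then vdim A i else inner_size i s.

Arguments size_body : clear implicits.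

Definition nsize : 'I_N -> nat :=
  Fix (@is_child_wf N M T) (fun=> nat)
    (fun i rec => size_body i (fun l => rec (child l) (is_childP l))).

Lemma nsizeE (i : 'I_N) : nsize i = size_body i (fun l => nsize (child l)).
Proof.
rewrite /nsize Fix_eq // => {}i f g fg; rewrite /size_body /inner_size.
by congr (if _ then _ else (_ + _ + _)%N); apply: eq_bigr => l _.
Qed.

(** ** The matrices of the recursion *)

(* [Cnest k] is the nested matrix of the vertex [tgt T k], whose entering arc
   is [k]. *)
Definition Cnest (k : 'I_M) : 'M[R]_(adim A k, nsize (tgt T k)) :=
  castmx (erefl, esym (nsizeE (tgt T k)))
    (if leaf T (tgt T k) as b
       return 'M[R]_(adim A k,
                     if b then vdim A (tgt T k) else inner_size (tgt T k) _)
     then Cminus A k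
     else row_mx (row_mx 0 (Cminus A k)) 0).

Definition Dle (i : 'I_N) : 'M[R]_(\sum_(l < outdeg T i) adim A (outarc l)) :=
  \mxdiag_(l < outdeg T i) Da A (outarc l).

Definition Cple (i : 'I_N) :
    'M[R]_(\sum_(l < outdeg T i) adim A (outarc l), vdim A i) :=
  \mxcol_(l < outdeg T i)
    castmx (erefl, congr1 (vdim A) (src_outarc l)) (Cplus A (outarc l)).

Definition Cmle (i : 'I_N) :
    'M[R]_(\sum_(l < outdeg T i) adim A (outarc l),
           \sum_(l < outdeg T i) nsize (child l)) :=
  blkdiag (fun l : 'I_(outdeg T i) => Cnest (outarc l)).

Definition Ble_body (i : 'I_N)
    (Bc : forall l : 'I_(outdeg T i), 'M[R]_(nsize (child l))) :
    'M[R]_(size_body i (fun l => nsize (child l))) :=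
  if leaf T i as b return 'M[R]_(if b then vdim A i else inner_size i _)
  then Bv A i
  else block_mx
         (block_mx (\mxdiag_(l < outdeg T i) Bc l) 0 0 (Bv A i))
         (col_mx (- (Cmle i)^T) (Cple i)^T)
         (row_mx (- Cmle i) (Cple i))
         (- Dle i).

Definition Ble : forall i : 'I_N, 'M[R]_(nsize i) :=
  Fix (@is_child_wf N M T) (fun i => 'M[R]_(nsize i))
    (fun i rec => castmx (esym (nsizeE i), esym (nsizeE i))
       (Ble_body (fun l => rec (child l) (is_childP l)))).

Lemma BleE (i : 'I_N) :
  Ble i = castmx (esym (nsizeE i), esym (nsizeE i))
            (Ble_body (fun l => Ble (child l))).
Proof.
rewrite /Ble Fix_eq // => {}i f g fg; congr (castmx _ _).
rewrite /Ble_body; suff -> : \mxdiag_(l < outdeg T i) f (child l) (is_childP l) =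
  \mxdiag_(l < outdeg T i) g (child l) (is_childP l) by [].
by apply: eq_mxdiag => l.
Qed.

(* Only meaningful when [i] is an inner vertex. *)
Definition Sle (i : 'I_N) : 'M[R]_(\sum_(l < outdeg T i) adim A (outarc l)) :=
  row_mx (- Cmle i) (Cple i)
    *m block_mx (\mxdiag_(l < outdeg T i) invmx (Ble (child l))) 0
                0 (invmx (Bv A i))
    *m (row_mx (- Cmle i) (Cple i))^T
  + Dle i.

(** ** The global Schur complement *)

Definition Bglob : 'M[R]_(\sum_i vdim A i) := \mxdiag_i Bv A i.

Definition Dglob : 'M[R]_(\sum_k adim A k) := \mxdiag_k Da A k.

Definition Cglob : 'M[R]_(\sum_k adim A k, \sum_i vdim A i) :=
  \mxblock_(k, i) (if src T k == i then conform_mx 0 (Cplus A k)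
                   else if tgt T k == i then - conform_mx 0 (Cminus A k)
                   else 0).

Definition Sglob : 'M[R]_(\sum_k adim A k) :=
  Cglob *m invmx Bglob *m Cglob^T + Dglob.

(** ** The recursive preconditioner *)

Definition Prec (i : 'I_N)
    (Pc : forall l : 'I_(outdeg T i), 'M[R]_(nsize (child l))) :
    'M[R]_(nsize i) :=
  castmx (esym (nsizeE i), esym (nsizeE i))
    (if leaf T i as b return 'M[R]_(if b then vdim A i else inner_size i _)
     then Bv A i
     else block_mx
            (block_mx (\mxdiag_(l < outdeg T i) Pc l) 0 0 (Bv A i))
            0
            (row_mx (- Cmle i) (Cple i))
            (- Sle i)).

End Nested.

Arguments Prec {R N M T} A {i} Pc.

(* Main.v *)
Require Import Defs.
From mathcomp Require Import all_boot all_order all_algebra.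
From mathcomp Require Import reals.

Import GRing.Theory Num.Theory.

Local Open Scope ring_scope.

(** At an inner vertex write [K = blkdiag(B_{j_1}, ..., B_{j_r}, B_i)] for the
    nested matrices of the children together with the vertex block, and [E] for
    the coupling row [(-C^-, C^+)].  The nested matrix is the saddle-point
    matrix [B = (K, E^T; E, -D)], and a preconditioner that is exact on the
    children is [P = (K, 0; E, -S)] with the Schur complement
    [S = E K^-1 E^T + D].  This is the lower factor of a block LU factorization:
    [B = P (1 + U)] with [U = (0, K^-1 E^T; 0, 0)] strictly block upper
    triangular, so [U^2 = 0] ([block_LU_nilpotent_defect]).  The error of the
    iteration is multiplied by [1 - P^-1 B = - U] at each step, hence it
    vanishes after two steps ([nilpotent_defect_iteration]).  At a leaf
    [P = B] and [U = 0].  The matrix [P] is invertible because [K] is and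
    because the positive definite [S] is. *)

(** The defect [1 - P^-1 B], stated without an inverse as [B = P (1 + U)], has
    square zero.  Keeping the size [n] as the only index lets the property be
    transported along the size equations of the nested matrices. *)
Definition nilpotent_defect {F : fieldType} {n} (P B : 'M[F]_n) : Prop :=
  P \in unitmx /\ exists2 U : 'M[F]_n, B = P *m (1%:M + U) & U *m U = 0.

Lemma nilpotent_defect_refl (F : fieldType) n (P : 'M[F]_n) :
  P \in unitmx -> nilpotent_defect P P.
Proof. by move=> uP; split=> //; exists 0; rewrite ?addr0 ?mulmx1 ?mulmx0. Qed.

Lemma nilpotent_defect_cast (F : fieldType) m n (e : m = n) (P B : 'M[F]_m) :
  nilpotent_defect P B ->
  nilpotent_defect (castmx (e, e) P) (castmx (e, e) B).
Proof. by case: n / e; rewrite !castmx_id. Qed.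

(** Each step maps the error [x k - B^-1 h] to [- U] times itself, so the
    second step already produces [U^2 = 0]. *)
Lemma nilpotent_defect_iteration (F : fieldType) n (P B : 'M[F]_n)
    (h : 'cV[F]_n) (x : nat -> 'cV[F]_n) :
  nilpotent_defect P B -> B \in unitmx ->
  (forall k, x k.+1 = x k + invmx P *m (h - B *m x k)) ->
  forall k, (2 <= k)%N -> x k = invmx B *m h.
Proof.
move=> [uP [U BE UU]] uB xS.
have errS k : x k.+1 - invmx B *m h = - (U *m (x k - invmx B *m h)).
  rewrite xS.
  have -> : h - B *m x k = P *m ((1%:M + U) *m (invmx B *m h - x k)).
    by rewrite mulmxA -BE mulmxBr mulKVmx.
  rewrite mulKmx // mulmxDl mul1mx -[in RHS]mulmxN opprB.
  by rewrite addrA [x k + _]addrC subrK addrAC subrr add0r.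
move=> [|[|k]] // _; apply/eqP; rewrite -subr_eq0 !errS.
by rewrite mulmxN opprK mulmxA UU mul0mx.
Qed.

(** Block LU factorization of the saddle-point matrix: its lower factor is the
    preconditioner and its unit upper factor is [1 + U] with
    [U = (0, K^-1 E^T; 0, 0)]. *)
Lemma block_LU_nilpotent_defect (F : fieldType) m n (K : 'M[F]_m)
    (E : 'M[F]_(n, m)) (D S : 'M[F]_n) :
  K \in unitmx -> S \in unitmx -> S = E *m invmx K *m E^T + D ->
  nilpotent_defect (block_mx K 0 E (- S)) (block_mx K E^T E (- D)).
Proof.
move=> uK uS SE; split.
  rewrite unitmxE det_lblock unitrM -!unitmxE uK.
  by rewrite -scaleN1r unitmxZ // unitrN1.
exists (block_mx 0 (invmx K *m E^T) 0 0); last first.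
  by rewrite mulmx_block !(mul0mx, mulmx0, addr0) block_mx0.
rewrite mulmxDr mulmx1 mulmx_block !(mulmx0, addr0) add_block_mx !addr0 add0r.
by rewrite mulKVmx // mulmxA SE opprD addrAC addNr add0r.
Qed.

Lemma posdefmx_unit (R : realType) n (A : 'M[R]_n) :
  posdefmx A -> A \in unitmx.
Proof.
move=> pA; rewrite unitmxE unitfE; apply/negP => /det0P[v v0 vA].
have /pA : v^T != 0 by rewrite trmx_eq0.
by rewrite trmxK vA mul0mx mxE Order.POrderTheory.ltxx.
Qed.

Lemma mul_mxdiag_invmx (F : fieldType) r (p : 'I_r -> nat)
    (A : forall l, 'M[F]_(p l)) :
  (forall l, A l \in unitmx) ->
  (\mxdiag_l A l) *m (\mxdiag_l invmx (A l)) = 1%:M.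
Proof.
move=> uA; rewrite mul_mxdiag_mxblock -[RHS]mxdiagZ.
apply/eq_mxblock => l l'; case: eqP => [<-|_]; last by rewrite mulmx0.
by rewrite conform_mx_id mulmxV ?conform_mx_id.
Qed.

Lemma invmx_mxdiag_block (F : fieldType) r (p : 'I_r -> nat) m
    (A : forall l, 'M[F]_(p l)) (B : 'M[F]_m) :
  (forall l, A l \in unitmx) -> B \in unitmx ->
  block_mx (\mxdiag_l A l) 0 0 B \in unitmx /\
  invmx (block_mx (\mxdiag_l A l) 0 0 B) =
    block_mx (\mxdiag_l invmx (A l)) 0 0 (invmx B).
Proof.
move=> /mul_mxdiag_invmx AV uB; have [uA _] := mulmx1_unit AV.
have uK : block_mx (\mxdiag_l A l) 0 0 B \in unitmx.
  by rewrite block_diag_mx_unit uA uB.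
split=> //; rewrite invmx_block_diag //.
by rewrite -[\mxdiag_l invmx _](mulKmx uA) AV mulmx1.
Qed.

Theorem lemma3p3 (R : realType) (N M : nat) (T : arborescence N M)
    (A : tree_data R T)
    (Bv_unit : forall j : 'I_N, Bv A j \in unitmx)
    (Ble_unit : forall j : 'I_N, Ble A j \in unitmx)
    (Sle_posdef : forall j : 'I_N, ~~ leaf T j -> posdefmx (Sle A j))
    (Sglob_posdef : posdefmx (Sglob A))
    (i : 'I_N)
    (Pc : forall l : 'I_(outdeg T i), 'M[R]_(nsize A (child l)))
    (Pc_unit : forall l : 'I_(outdeg T i), Pc l \in unitmx)
    (Pc_exact : forall l : 'I_(outdeg T i), Pc l = Ble A (child l)) :
  Prec A Pc \in unitmx /\
  forall (h : 'cV[R]_(nsize A i)) (x : nat -> 'cV[R]_(nsize A i)),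
    (forall k : nat,
       x k.+1 = x k + invmx (Prec A Pc) *m (h - Ble A i *m x k)) ->
    forall k : nat, (2 <= k)%N -> x k = invmx (Ble A i) *m h.
Proof.
suff defect : nilpotent_defect (Prec A Pc) (Ble A i).
  split; first by case: defect.
  by move=> h x; apply: nilpotent_defect_iteration.
have uS : ~~ leaf T i -> Sle A i \in unitmx by move/Sle_posdef/posdefmx_unit.
(* The block size, [P] and [B] are all defined by cases on [leaf T i]; unfolding
   them under the size cast makes the case analysis act on the three at once. *)
rewrite BleE /Prec; apply: nilpotent_defect_cast.
rewrite /Ble_body /size_body.
case: (leaf T i) uS => /= [_|/(_ isT) uS]; first exact: nilpotent_defect_refl.
rewrite (eq_mxdiag Pc_exact).
have uBc (l : 'I_(outdeg T i)) : Ble A (child l) \in unitmx by [].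
have [uK KV] := invmx_mxdiag_block _ _ _ _ _ _ uBc (Bv_unit i).
have -> : col_mx (- (Cmle A i)^T) (Cple A i)^T =
          (row_mx (- Cmle A i) (Cple A i))^T by rewrite tr_row_mx linearN.
by apply: block_LU_nilpotent_defect => //; rewrite KV.
Qed.
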